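(* Let $\mathcal R$ be either $(\mathbb R,<,+,0)$ or $(\mathbb R,<,+,0,\Lambda)$, where $\Lambda$ is the set of all real scalar functions on $\mathbb R$. Let $D$ be a countable subset of $\mathbb R$ such that $(\mathcal R,D)$ is locally o-minimal. Let $E$ be a compact subset of $\mathbb R$ which is a union of finitely many discrete sets. Let $U$ be an open subset of $\mathbb R^n$ and let $f:U\to\mathbb R^m$ be a continuous function definable in $(\mathcal R,D\cup E)^{\#}$. Then there exists a dense open subset $V$ of $U$, definable in $(\mathcal R,D\cup E)^{\#}$, such that the restriction of $f$ to $V$ is locally affine.
   Context: The real scalar functions on $\mathbb R$ are the maps $x\mapsto \lambda x$, $\lambda\in\mathbb R$. ''Definable'' means definable with parameters. A subset of a topological space is discrete if its subspace topology is discrete. An expansion $(M,<,\ldots)$ of a dense linear order without endpoints is locally o-minimal if for every definable subset $X$ of $M$ and every point $a\in M$ there exists an open interval $I$ with $a\in I$ such that $X\cap I$ is a finite union of points and open intervals. $(\mathcal R,D)$ denotes the expansion of $\mathcal R$ by a unary predicate for $D$. For an o-minimal expansion $\mathcal R$ of $(\mathbb R,<,+)$ and $F\subseteq\mathbb R$, $(\mathcal R,F)^{\#}$ denotes the expansion of $\mathcal R$ by predicates for all nonempty subsets $S$ of all Cartesian powers $F^k$ ($k$ ranging over all positive integers). A map $f:U\to\mathbb R^m$ on an open set $U \subseteq \mathbb R^n$ is locally affine if for every $x\in U$ there exists an open neighborhood $V$ of $x$ in $U$ such that the restriction of $f$ to $V$ coincides with the restriction of an affine map to $V$. *)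

(* Defs.v *)
From HB Require Import structures.
From mathcomp Require Import all_boot all_order all_algebra.
From mathcomp Require Import all_classical all_reals all_analysis.
Import Order.TTheory GRing.Theory Num.Theory.
Import numFieldNormedType.Exports.

Set Implicit Arguments.
Unset Strict Implicit.
Unset Printing Implicit Defensive.

Local Open Scope classical_set_scope.
Local Open Scope ring_scope.

(* A first-order structure with universe M: a signature together with its
   interpretation. The k-th Cartesian power of M is 'rV[M]_k. *)
Record structure (M : Type) := Structure {
  fsym : Type;
  far : fsym -> nat;
  fint : forall s : fsym, 'rV[M]_(far s) -> M;
  rsym : Type;
  rar : rsym -> nat;
  rint : forall s : rsym, set 'rV[M]_(rar s) }.

Section FirstOrder.
Context {M : Type}.
Implicit Type L : structure M.

Inductive term L :=
| Var of nat
| App (s : fsym L) of ('I_(far s) -> term L).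

Inductive formula L :=
| Eq of term L & term L
| Rel (s : rsym L) of ('I_(rar s) -> term L)
| Bot
| Imp of formula L & formula L
| All of nat & formula L.

Fixpoint eval L (e : nat -> M) (t : term L) : M :=
  match t with
  | Var i => e i
  | App s a => fint (\row_i eval e (a i))
  end.

Definition upd (e : nat -> M) (i : nat) (a : M) : nat -> M :=
  fun j => if j == i then a else e j.

Fixpoint holds L (e : nat -> M) (p : formula L) : Prop :=
  match p with
  | Eq t u => eval e t = eval e u
  | Rel s a => rint (\row_i eval e (a i))
  | Bot => False
  | Imp p q => holds e p -> holds e q
  | All i p => forall a : M, holds (upd e i a) p
  end.

Definition env n (x : 'rV[M]_n) (e : nat -> M) : nat -> M :=
  fun i => if insub i is Some j then x ord0 j else e i.

(* Definability with parameters: the variables below n are the coordinates,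
   and every other free variable takes a fixed value in M, given by e. *)
Definition definable L n (X : set 'rV[M]_n) : Prop :=
  exists (p : formula L) (e : nat -> M), X = [set x | holds (env x e) p].

Definition definable1 L (X : set M) : Prop :=
  definable L [set x : 'rV[M]_1 | X (x ord0 ord0)].

Definition definable_fun L n m (U : set 'rV[M]_n) (f : 'rV[M]_n -> 'rV[M]_m) :
    Prop :=
  definable L [set row_mx x (f x) | x in U].

Definition expansion L (I : Type) (ar : I -> nat)
    (P : forall i, set 'rV[M]_(ar i)) : structure M :=
  @Structure M (fsym L) (@far M L) (@fint M L) (rsym L + I)%type
    (fun s => match s with inl r => rar r | inr i => ar i end)
    (fun s => match s with inl r => @rint M L r | inr i => P i end).

Definition expansion1 L (D : set M) : structure M :=
  expansion L (fun _ : unit => [set x : 'rV[M]_1 | D (x ord0 ord0)]).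

Record power_subset (F : set M) := PowerSubset {
  ps_dim : nat;
  ps_set : set 'rV[M]_ps_dim;
  ps_dim_gt0 : (0 < ps_dim)%N;
  ps_nonempty : ps_set !=set0;
  ps_sub : forall x, ps_set x -> forall i, F (x ord0 i) }.

Definition sharp L (F : set M) : structure M :=
  expansion L (@ps_set F).

End FirstOrder.

Variant group_fsym := GAdd | GZero.

Definition group_far (s : group_fsym) : nat :=
  match s with GAdd => 2 | GZero => 0 end.

Section RealStructures.
Variable R : realType.

Definition group_fint (s : group_fsym) : 'rV[R]_(group_far s) -> R :=
  match s with
  | GAdd => fun x => x ord0 ord0 + x ord0 ord_max
  | GZero => fun=> 0
  end.

Definition lt_rint (_ : unit) : set 'rV[R]_2 :=
  [set x | x ord0 ord0 < x ord0 ord_max].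

Definition ordered_group : structure R :=
  @Structure R group_fsym group_far group_fint unit (fun=> 2%N) lt_rint.

Definition ordered_vector_space : structure R :=
  @Structure R (group_fsym + R)%type
    (fun s => match s with inl g => group_far g | inr _ => 1%N end)
    (fun s => match s with
              | inl g => @group_fint g
              | inr a => fun x => a * x ord0 ord0
              end)
    unit (fun=> 2%N) lt_rint.

Definition open_interval (I : set R) : Prop :=
  exists a b : \bar R, I = [set x | (a < x%:E < b)%E].

Definition finite_union_points_intervals (X : set R) : Prop :=
  exists C : set (set R),
    [/\ finite_set C,
        forall J, C J -> (exists c, J = [set c]) \/ open_interval J
      & X = \bigcup_(J in C) J].

Definition locally_ominimal (L : structure R) : Prop :=
  forall X : set R, definable1 L X -> forall a : R,
    exists I : set R,
      [/\ open_interval I, I a & finite_union_points_intervals (X `&` I)].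

Definition affine_map n m (g : 'rV[R]_n -> 'rV[R]_m) : Prop :=
  exists (A : 'M[R]_(n, m)) (b : 'rV[R]_m), forall x, g x = x *m A + b.

Definition locally_affine n m (U : set 'rV[R]_n) (f : 'rV[R]_n -> 'rV[R]_m) :
    Prop :=
  forall x, U x -> exists V : set 'rV[R]_n,
    [/\ open V, V x, V `<=` U
      & exists2 g, affine_map g & forall y, V y -> f y = g y].

End RealStructures.

Definition discrete_subset (T : topologicalType) (A : set T) : Prop :=
  forall B : set (set_type A), open B.

Definition finite_union_discrete (T : topologicalType) (E : set T) : Prop :=
  exists C : set (set T),
    [/\ finite_set C, forall A, C A -> discrete_subset A
      & E = \bigcup_(A in C) A].

(* Main.v *)
Require Import Defs.
From HB Require Import structures.
From mathcomp Require Import all_boot all_order all_algebra.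
From mathcomp Require Import all_classical all_reals all_analysis.
From mathcomp Require Import ring lra.
Import Order.TTheory GRing.Theory Num.Theory.
Import numFieldNormedType.Exports.
Local Open Scope classical_set_scope.
Local Open Scope ring_scope.
Set Implicit Arguments.
Unset Strict Implicit.
Unset Printing Implicit Defensive.

(** Why the theorem holds. Every subset of R^n definable in the expansion by all
    relations on F = D `|` E is a union of cells of an affine arrangement: finitely
    many linear forms l_j are given, each with a closed countable set Z_j of values,
    and the cell of a point records on which side of every z in Z_j the value of l_j
    lies, or that it is equal to z. This is proved by induction on formulas
    ([sharp_formula_decided]). An arbitrary relation on F causes no difficulty:
    it constrains only terms whose values lie in F, and when F is contained in
    Z_j the cell determines which element of F the term is equal to.

    Quantifiers are handled by eliminating a variable x as in the method of
    Fourier and Motzkin ([elim_varP]). The conditions m_j + c_j x = z cut the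
    x-line at the points (z - m_j) / c_j, whose relative order is determined by
    the position of c_k m_j - c_j m_k with respect to the elements of
    c_k Z_j - c_j Z_k. Although there are infinitely many such points, they form
    a closed set, so that a value of x which is none of them has a nearest one on
    each side where there are any; hence it can be transferred from one point of a cell to another
    ([back_and_forth]).

    Elimination requires that the sets generated from F by sums and dilations
    be closed and countable, and this is where the hypotheses on D and E enter
    ([thin_cut_class]). A set generated from D is countable and definable in the
    expansion by D, hence locally finite by local o-minimality, hence closed. A
    set generated from E is compact and countable. A sum of a closed and a compact
    set is closed.

    For the theorem, take an arrangement for the graph of f, eliminate the m
    coordinates of the value, and let V be the set of the points of U that lie on
    no hyperplane of the resulting arrangement (forms that do not depend on the point
    of U are disregarded). The set V is definable since the
    forms and the cuts are, open since the cuts are closed, and dense since they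
    are countable ([generic_dense]). Near a point x of V the points x' remain in
    the same cell, so that the points (x', f x') all lie in one cell of the
    arrangement for the graph. Cells are convex and this one is contained in
    the graph; thus f preserves convex combinations near x
    ([graph_decided_affine]), and such a function is affine on a ball
    ([conv_affine]). *)

(** * Definable predicates on environments *)

Section FirstOrderDefinability.
Context {M : Type}.
Implicit Type L : structure M.

Fixpoint term_bound L (t : term L) : nat :=
  match t with
  | Var i => i.+1
  | App s a => \max_i term_bound (a i)
  end.

Fixpoint formula_bound L (p : formula L) : nat :=
  match p with
  | Eq t u => maxn (term_bound t) (term_bound u)
  | Rel s a => \max_i term_bound (a i)
  | Bot => 0
  | Imp p q => maxn (formula_bound p) (formula_bound q)
  | All _ p => formula_bound p
  end.

Fixpoint rename_term L (r : nat -> nat) (t : term L) : term L :=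
  match t with
  | Var i => Var L (r i)
  | App s a => App (fun i => rename_term r (a i))
  end.

Lemma eval_agree L (t : term L) (e e' : nat -> M) :
  (forall j, (j < term_bound t)%N -> e j = e' j) ->
  Defs.eval e t = Defs.eval e' t.
Proof.
elim: t => [i|s a IH] /= ee'; first exact: ee'.
congr fint; apply/rowP => i; rewrite !mxE; apply: IH => j jb.
by apply: ee'; apply: (leq_trans jb); exact: (leq_bigmax i).
Qed.

Lemma holds_agree L (p : formula L) (e e' : nat -> M) :
  (forall j, (j < formula_bound p)%N -> e j = e' j) ->
  holds e p <-> holds e' p.
Proof.
elim: p e e' => [t u|s a||p IHp q IHq|i p IH] e e' /= ee' //.
- by rewrite (eval_agree (t := t) (e' := e')) ?(eval_agree (t := u) (e' := e'))
    // => j jb; apply: ee'; rewrite leq_max jb ?orbT.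
- rewrite (_ : \row_i Defs.eval e (a i) = \row_i Defs.eval e' (a i)) //.
  apply/rowP => i; rewrite !mxE; apply: eval_agree => j jb.
  by apply: ee'; apply: (leq_trans jb); exact: (leq_bigmax i).
- have Hp : holds e p <-> holds e' p.
    by apply: IHp => j jb; apply: ee'; rewrite leq_max jb.
  have Hq : holds e q <-> holds e' q.
    by apply: IHq => j jb; apply: ee'; rewrite leq_max jb orbT.
  tauto.
- have H a : holds (upd e i a) p <-> holds (upd e' i a) p.
    by apply: IH => j jb; rewrite /upd; case: eqP => // _; exact: ee'.
  by split=> h a; apply/H.
Qed.

Lemma eval_rename L r (t : term L) (e : nat -> M) :
  Defs.eval e (rename_term r t) = Defs.eval (e \o r) t.
Proof.
elim: t => //= s a IH; congr fint; apply/rowP => i.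
by rewrite !mxE IH.
Qed.

(** The renaming [r] need not be injective: a bound variable is first sent to
    an index above the images of all variables that occur. *)
Lemma rename_formula L (p : formula L) (r : nat -> nat) :
  exists q : formula L, forall e, holds e q <-> holds (e \o r) p.
Proof.
elim: p r => [t u|s a||p IHp q IHq|i p IH] r.
- by exists (Eq (rename_term r t) (rename_term r u)) => e /=; rewrite !eval_rename.
- exists (Rel (fun i => rename_term r (a i))) => e /=.
  rewrite (_ : (\row_i _) = \row_i Defs.eval (e \o r) (a i)) //.
  by apply/rowP => i; rewrite !mxE eval_rename.
- by exists (Bot L).
- have [p' Hp] := IHp r; have [q' Hq] := IHq r.
  by exists (Imp p' q') => e /=; rewrite Hp Hq.
- pose k := (\max_(j < formula_bound p) (r j)).+1.
  have [q Hq] := IH (fun j => if j == i then k else r j).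
  exists (All k q) => e /=.
  suff H a : holds (upd e k a) q <-> holds (upd (e \o r) i a) p.
    by split=> h a; apply/H.
  rewrite Hq; apply: holds_agree => j jb; rewrite /upd /=.
  case: (j =P i) => [_|_]; first by rewrite eqxx.
  case: eqP => // rk; have := leq_bigmax (F := fun j : 'I_(formula_bound p) => r j)
    (Ordinal jb).
  by rewrite /= rk /k ltnn.
Qed.

(** Parameter-free definability, for predicates on the assignments of all the
    variables at once: finitely many variables matter, but no arity has to be
    carried around. *)
Definition env_definable L (P : (nat -> M) -> Prop) : Prop :=
  exists p : formula L, forall e, holds e p <-> P e.

Definition env_cons (a : M) (e : nat -> M) : nat -> M :=
  fun i => if i is j.+1 then e j else a.

Lemma env_definable_iff L (P Q : (nat -> M) -> Prop) :
  (forall e, P e <-> Q e) -> env_definable L P -> env_definable L Q.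
Proof. by move=> PQ [p Hp]; exists p => e; rewrite Hp. Qed.

Lemma env_definable_rename L (P : (nat -> M) -> Prop) (r : nat -> nat) :
  env_definable L P -> env_definable L (fun e => P (fun i => e (r i))).
Proof.
by move=> [p Hp]; have [q Hq] := rename_formula p r; exists q => e; rewrite Hq Hp.
Qed.

Lemma env_definable_imp L (P Q : (nat -> M) -> Prop) :
  env_definable L P -> env_definable L Q -> env_definable L (fun e => P e -> Q e).
Proof. by move=> [p Hp] [q Hq]; exists (Imp p q) => e /=; rewrite Hp Hq. Qed.

Lemma env_definable_false L : env_definable L (fun=> False).
Proof. by exists (Bot L). Qed.

Lemma env_definable_not L (P : (nat -> M) -> Prop) :
  env_definable L P -> env_definable L (fun e => ~ P e).
Proof. by move=> dP; apply: env_definable_imp dP (env_definable_false L). Qed.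

Lemma env_definable_and L (P Q : (nat -> M) -> Prop) :
  env_definable L P -> env_definable L Q -> env_definable L (fun e => P e /\ Q e).
Proof.
move=> dP dQ.
apply: env_definable_iff (env_definable_not
  (env_definable_imp dP (env_definable_not dQ))) => e.
split=> [h|[p q] h]; last exact: h.
split; apply: contrapT => n; apply: h => ?; last exact: n.
by move=> _; apply: n.
Qed.

Lemma env_definable_or L (P Q : (nat -> M) -> Prop) :
  env_definable L P -> env_definable L Q -> env_definable L (fun e => P e \/ Q e).
Proof.
move=> dP dQ.
apply: env_definable_iff (env_definable_imp (env_definable_not dP) dQ) => e.
by split=> [pq|[p np|q _ //]]; [case: (pselect (P e)); auto | ].
Qed.

Lemma env_definable_cst L (b : Prop) : env_definable L (fun=> b).
Proof.
have T : env_definable L (fun=> ~ False) := env_definable_not (env_definable_false L).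
case: (pselect b) => Hb.
  by apply: env_definable_iff T => e; split=> // _ [].
by apply: env_definable_iff (env_definable_false L) => e; split.
Qed.

Lemma env_definable_all_seq L (I : Type) (s : seq I) (P : I -> (nat -> M) -> Prop) :
  (forall i, env_definable L (P i)) ->
  env_definable L (fun e => forall i, List.In i s -> P i e).
Proof.
move=> dP; elim: s => [|i s IH].
  by apply: env_definable_iff (env_definable_cst L True) => e; split.
apply: env_definable_iff (env_definable_and (dP i) IH) => e.
split=> [[Pi Ps] j /= [<-//|]|Ps]; first exact: Ps.
by split=> [|j js]; apply: Ps; [left|right].
Qed.

Lemma env_definable_all_fin L (I : finType) (P : I -> (nat -> M) -> Prop) :
  (forall i, env_definable L (P i)) -> env_definable L (fun e => forall i, P i e).
Proof.
move=> dP; apply: env_definable_iff (env_definable_all_seq (enum I) dP) => e.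
split=> [Ps i|Ps i _]; last exact: Ps.
apply: Ps; have : i \in enum I by rewrite mem_enum.
by elim: (enum I) => //= j s IH; rewrite in_cons => /orP[/eqP->|/IH]; [left|right].
Qed.

Lemma env_definable_all_upd L (P : (nat -> M) -> Prop) (i : nat) :
  env_definable L P -> env_definable L (fun e => forall a, P (upd e i a)).
Proof. by move=> [p Hp]; exists (All i p) => e /=; split=> h a; apply/Hp. Qed.

Lemma env_definable_ex_upd L (P : (nat -> M) -> Prop) (i : nat) :
  env_definable L P -> env_definable L (fun e => exists a, P (upd e i a)).
Proof.
move=> dP; apply: env_definable_iff (env_definable_not
  (env_definable_all_upd i (env_definable_not dP))) => e.
by split=> [/existsNP[a /contrapT]|[a Pa] /(_ a)]; [exists a|].
Qed.

(** De Bruijn style quantification: no name has to be chosen for the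
    quantified variable. *)
Lemma env_definable_ex L (P : (nat -> M) -> Prop) :
  env_definable L P -> env_definable L (fun e => exists a, P (env_cons a e)).
Proof.
move=> [p Hp]; pose k := formula_bound p.
pose r j := if j is j'.+1 then j' else k.
have := env_definable_ex_upd k (env_definable_rename r (ex_intro _ p Hp)).
apply: env_definable_iff => e.
suff H a : P (fun i => upd e k a (r i)) <-> P (env_cons a e).
  by split=> -[a] /H; exists a.
rewrite -!Hp; apply: holds_agree => -[|j] jb; rewrite /upd /= ?eqxx //.
by case: eqP => // jk; move: jb; rewrite jk /k ltnNge leqnSn.
Qed.

Definition splice (k m : nat) (g e : nat -> M) : nat -> M :=
  fun i => if (k <= i < k + m)%N then g i else e i.

Lemma splice0 k g e : splice k 0 g e = e.
Proof. by apply/funext => i; rewrite /splice addn0 ltnNge andbN. Qed.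

Lemma spliceS k m g e : splice k m.+1 g e = splice k.+1 m g (upd e k (g k)).
Proof.
apply/funext => i; rewrite /splice /upd addnS addSn.
by case: (ltngtP k i) => //= <-; rewrite ltnS leq_addr.
Qed.

Lemma splice_agree k m g g' e : (forall i, (k <= i < k + m)%N -> g i = g' i) ->
  splice k m g e = splice k m g' e.
Proof. by move=> gg'; apply/funext => i; rewrite /splice; case: ifP => // /gg'. Qed.

Lemma env_definable_ex_splice L (P : (nat -> M) -> Prop) (k m : nat) :
  env_definable L P -> env_definable L (fun e => exists g, P (splice k m g e)).
Proof.
move=> dP; elim: m k => [|m IH] k.
  apply: env_definable_iff dP => e.
  by split=> [Pe|[g]]; [exists e|]; rewrite splice0.
apply: env_definable_iff (env_definable_ex_upd k (IH k.+1)) => e.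
split=> [[a [g Pg]]|[g]]; last by rewrite spliceS; exists (g k), g.
exists (upd g k a); rewrite spliceS (_ : upd g k a k = a); last by rewrite /upd eqxx.
rewrite (splice_agree (g' := g)) // => i /andP[ki _]; rewrite /upd.
by case: eqP ki => // ->; rewrite ltnn.
Qed.

Lemma definable_env L n (P : (nat -> M) -> Prop) (e : nat -> M) :
  env_definable L P -> definable L [set x : 'rV[M]_n | P (env x e)].
Proof.
by move=> [p Hp]; exists p, e; apply/seteqP; split=> x /=; rewrite Hp.
Qed.

Lemma env_lt n (x : 'rV[M]_n) e (i : 'I_n) : env x e i = x ord0 i.
Proof. by rewrite /env valK. Qed.

Lemma env_ge n (x : 'rV[M]_n) e i : (n <= i)%N -> env x e i = e i.
Proof. by move=> ni; rewrite /env insubF // ltnNge ni. Qed.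

End FirstOrderDefinability.

(** * Countable sets of real numbers *)

Section CountableSets.
Context {R : realType}.
Implicit Types A B Z : set R.

Definition sumset A B : set R := [set a + b | a in A & b in B].

Definition dilate (a : R) A : set R := [set a * x | x in A].

Lemma countable_sumset A B : countable A -> countable B -> countable (sumset A B).
Proof.
move=> cA cB; rewrite /sumset image2E.
by apply: sub_countable (card_image_le _ _) _; exact: countableX.
Qed.

Lemma countable_dilate a A : countable A -> countable (dilate a A).
Proof. by move=> cA; apply: sub_countable (card_image_le _ _) cA. Qed.

Lemma compact_sumset A B : compact A -> compact B -> compact (sumset A B).
Proof.
move=> cA cB; rewrite /sumset image2E.
apply: continuous_compact (compact_setX cA cB).
apply: continuous_subspaceT => -[x y].
rewrite (_ : uncurry _ = fun p : R * R => p.1 + p.2); last by apply/funext => -[].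
exact: (@add_continuous R (x, y)).
Qed.

Lemma compact_dilate a A : compact A -> compact (dilate a A).
Proof.
move=> cA; apply: continuous_compact cA.
by apply: continuous_subspaceT => x; exact: mulrl_continuous.
Qed.

(** By compactness of [B], a point outside of the sum has a neighbourhood whose
    translates by the opposites of the elements of [B] all avoid [A]. *)
Lemma closed_sumset A B : closed A -> compact B -> closed (sumset A B).
Proof.
move=> clA /compact_near_coveringP cB.
rewrite -[sumset A B]setCK; apply: open_closedC; rewrite openE => z /= nz.
have : \forall z' \near z, B `<=` (fun b => ~ A (z' - b)).
  apply: (cB R (nbhs z) (fun z' b => ~ A (z' - b))) => b Bb /=.
  have nA : nbhs (z - b) (~` A).
    apply: open_nbhs_nbhs; split; first exact: closed_openC.
    by move=> Azb; apply: nz; exists (z - b) => //; exists b => //; rewrite subrK.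
  have : (fun p : R * R => p.2 - p.1) @ (b, z) --> z - b.
    exact: (@cvgB _ _ _ _ _ snd fst _ _ cvg_snd cvg_fst).
  by move=> /(_ _ nA).
apply: filterS => z' h [a Aa [b Bb abz]]; apply: (h b Bb).
by rewrite -abz addrK.
Qed.

(** A countable set has measure zero. *)
Lemma countable_avoid Z (a b : R) : countable Z -> a < b ->
  exists2 t, a < t < b & ~ Z t.
Proof.
move=> cZ ab; apply: contrapT => h.
have sub : `]a, b[ `<=` Z.
  move=> t /=; rewrite in_itv /= => abt; apply: contrapT => nZ.
  by apply: h; exists t.
have := countable_lebesgue_measure0 (sub_countable (subset_card_le sub) cZ).
rewrite lebesgue_measure_itv /= lte_fin ab -EFinB => -[] /eqP.
by rewrite subr_eq0 gt_eqF.
Qed.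

Lemma open_interval_open (I : set R) : open_interval I -> open I.
Proof.
move=> [a [b ->]].
rewrite (_ : [set x | _] = [set x | (a < x%:E)%E] `&` [set x | (x%:E < b)%E]).
  by apply: openI; [exact: open_ereal_gt|exact: open_ereal_lt].
by apply/seteqP; split=> x /= => [/andP[]|[-> ->]].
Qed.

Lemma open_countable0 (I : set R) : open I -> countable I -> I = set0.
Proof.
move=> oI cI; apply/seteqP; split=> // x Ix.
have /nbhs_ballP[d /= d0 dI] := open_nbhs_nbhs (conj oI Ix).
have [t /andP[xt td] []] : exists2 t, x < t < x + d & ~ I t.
  by apply: countable_avoid => //; rewrite ltrDl.
apply: dI; rewrite /ball /= ltr0_norm; lra.
Qed.

(** A nonempty open interval is uncountable, so that local o-minimality makes a
    countable definable set locally finite. *)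
Lemma locally_ominimal_closed (L : structure R) A :
  locally_ominimal L -> countable A -> definable1 L A -> closed A.
Proof.
move=> lo cA /lo {}lo; rewrite -[A]setCK; apply: open_closedC.
rewrite openE => a /= nAa.
have [I [/open_interval_open oI Ia [C [finC CJ AI]]]] := lo a.
have finAI : finite_set (A `&` I).
  rewrite AI; apply: bigcup_finite => // J CJJ.
  have [[c ->]|/open_interval_open oJ] := CJ J CJJ; first exact: finite_set1.
  rewrite (open_countable0 oJ) //.
  apply: sub_countable (subset_card_le _) cA => x Jx.
  by have [] : (A `&` I) x by rewrite AI; exists J.
have : nbhs a (I `&` ~` (A `&` I)).
  apply: open_nbhs_nbhs; split; last by split=> // -[].
  apply: openI => //; apply: closed_openC.
  exact: (accessible_finite_set_closed.1 (hausdorff_accessible (@Rhausdorff R))).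
by apply: filterS => x [Ix nAIx] Ax; apply: nAIx.
Qed.

(** Each point is isolated from the other ones by an interval with rational
    endpoints, and this interval determines the point. *)
Lemma discrete_countable A : discrete_subset A -> countable A.
Proof.
move=> dA.
have iso x : exists pq : rat * rat, A x ->
    ratr pq.1 < x < ratr pq.2 /\
    forall y, A y -> ratr pq.1 < y < ratr pq.2 -> y = x.
  have [Ax|nAx] := pselect (A x); last by exists (0, 0).
  pose x' : set_type A := SigSub (mem_set Ax).
  have [W oW Wx'] := dA [set x'].
  have Wx : W x by rewrite -[x]/(set_val x') -[W _]/((set_val @^-1` W) x') Wx'.
  have /nbhs_ballP[d /= d0 dW] := open_nbhs_nbhs (conj oW Wx).
  have /rat_in_itvoo[p] : x - d < x by rewrite ltrBlDr ltrDl.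
  have /rat_in_itvoo[q] : x < x + d by rewrite ltrDl.
  rewrite !in_itv /= => /andP[xq qd] /andP[dp px].
  exists (p, q) => _; split=> [|y Ay /andP[/= py yq]]; first by rewrite px.
  have : (set_val @^-1` W) (SigSub (mem_set Ay) : set_type A).
    apply: dW; rewrite /ball /= distrC ltr_distl; apply/andP; split.
      exact: lt_trans py.
    exact: lt_trans qd.
  by rewrite Wx' => -[].
have [f Hf] := choice iso.
apply/countable_injP; exists (pickle \o f).
move=> x y /set_mem Ax /set_mem Ay /= /(pcan_inj pickleK) fxy.
by apply: (Hf y Ay).2 => //; rewrite -fxy; case: (Hf x Ax).
Qed.

Lemma finite_union_discrete_countable A : finite_union_discrete A -> countable A.
Proof.
move=> [C [finC dC ->]]; apply: bigcup_countable; first exact: finite_set_countable.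
by move=> B /dC; exact: discrete_countable.
Qed.

End CountableSets.

(** * Linear forms and scalars *)

Section LinearForms.
Context {R : realType}.
Implicit Types (K : set R) (L : structure R) (Z : set R).

(** Linear forms in finitely many variables with coefficients in [K], seen as
    functions of an assignment of all the variables. *)
Inductive linear_form K : ((nat -> R) -> R) -> Prop :=
| form_var i : linear_form K (fun e => e i)
| form_zero : linear_form K (fun=> 0)
| form_add l l' : linear_form K l -> linear_form K l' ->
    linear_form K (fun e => l e + l' e)
| form_scale a l : K a -> linear_form K l -> linear_form K (fun e => a * l e).

Lemma form_comb K l (a b : R) (e e' : nat -> R) : linear_form K l ->
  l (fun i => a * e i + b * e' i) = a * l e + b * l e'.
Proof.
elim=> [i||l1 l2 _ -> _ ->|c l1 _ _ ->] //; first by rewrite !mulr0 addr0.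
- by rewrite !mulrDr addrACA.
- by rewrite mulrDr !(mulrCA c).
Qed.

Lemma form_upd K l (e : nat -> R) i a : linear_form K l ->
  l (upd e i a) = l (upd e i 0) + l (upd (fun=> 0) i 1) * a.
Proof.
move=> fl.
rewrite -[l (upd e i 0)]mul1r [_ * a]mulrC -(form_comb _ _ _ _ fl).
congr l; apply/funext => j; rewrite /upd; case: eqP => _.
  by rewrite mulr0 mulr1 add0r.
by rewrite mul1r mulr0 addr0.
Qed.

Lemma form_upd0 K l i : linear_form K l -> linear_form K (fun e => l (upd e i 0)).
Proof.
elim=> [j||l1 l2 _ h1 _ h2|c l1 Kc _ h1].
- rewrite /upd; case: eqP => _; [exact: form_zero|exact: form_var].
- exact: form_zero.
- exact: form_add.
- exact: form_scale.
Qed.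

Lemma form_continuous K l n (e : nat -> R) : linear_form K l ->
  continuous (fun x : 'rV[R]_n => l (env x e)).
Proof.
elim=> [i||l1 l2 _ h1 _ h2|c l1 Kc _ h1] x.
- have [lt_in|ni] := ltnP i n.
    rewrite (_ : (fun _ => _) = fun x : 'rV[R]_n => x ord0 (Ordinal lt_in)).
      exact: coord_continuous.
    by apply/funext => y; rewrite -(env_lt y e (Ordinal lt_in)).
  rewrite (_ : (fun _ => _) = fun=> e i); first exact: cst_continuous.
  by apply/funext => y; rewrite env_ge.
- exact: cst_continuous.
- exact: (continuousD (h1 x) (h2 x)).
- exact: (continuous_comp (h1 x) (@mulrl_continuous _ c _)).
Qed.

Definition addition_definable L := env_definable L (fun e => e 2%N = e 0%N + e 1%N).

(** The scalars are the elements for which the multiplication is definable. The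
    two base structures are thereby treated alike, although one of them has only
    natural numbers as coefficients of terms, and the other one all real numbers. *)
Definition scalar L (a : R) : Prop := env_definable L (fun e => e 1%N = a * e 0%N).

Lemma env_definable_add L i j k : addition_definable L ->
  env_definable L (fun e => e k = e i + e j).
Proof. exact: (env_definable_rename (nth 0%N [:: i; j; k])). Qed.

Lemma env_definable_scalar L a i j : scalar L a ->
  env_definable L (fun e => e j = a * e i).
Proof. exact: (env_definable_rename (nth 0%N [:: i; j])). Qed.

Lemma env_definable_zero L i : addition_definable L ->
  env_definable L (fun e => e i = 0).
Proof.
move=> /(env_definable_add i i i); apply: env_definable_iff => e.
split=> [/eqP|->]; last by rewrite addr0.
by rewrite -subr_eq subrr => /eqP.
Qed.

Lemma env_definable_set L Z i : env_definable L (fun e => Z (e 0%N)) ->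
  env_definable L (fun e => Z (e i)).
Proof. exact: (env_definable_rename (fun=> i)). Qed.

Section Scalars.
Context (L : structure R) (addL : addition_definable L).

Lemma scalar0 : scalar L 0.
Proof.
by apply: env_definable_iff (env_definable_zero 1 addL) => e; rewrite mul0r.
Qed.

Lemma scalar1 : scalar L 1.
Proof.
have := env_definable_ex (env_definable_and (env_definable_zero 0 addL)
  (env_definable_add 1 0 2 addL)).
apply: env_definable_iff => e; rewrite mul1r /=.
split=> [[z [-> ->]]|->]; first by rewrite addr0.
by exists 0; rewrite addr0.
Qed.

Lemma scalarD a b : scalar L a -> scalar L b -> scalar L (a + b).
Proof.
move=> sa sb; have := env_definable_ex (env_definable_ex (env_definable_and
  (env_definable_and (env_definable_scalar 2 1 sa) (env_definable_scalar 2 0 sb))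
  (env_definable_add 1 0 3 addL))).
apply: env_definable_iff => e /=; rewrite mulrDl.
by split=> [[u [v [[-> ->] ->]]]|->] //; exists (a * e 0%N), (b * e 0%N).
Qed.

Lemma scalarM a b : scalar L a -> scalar L b -> scalar L (a * b).
Proof.
move=> sa sb; have := env_definable_ex (env_definable_and
  (env_definable_scalar 1 0 sb) (env_definable_scalar 0 2 sa)).
apply: env_definable_iff => e /=; rewrite -mulrA.
by split=> [[u [-> ->]]|->] //; exists (b * e 0%N).
Qed.

Lemma scalarN a : scalar L a -> scalar L (- a).
Proof.
move=> sa; have := env_definable_ex (env_definable_ex (env_definable_and
  (env_definable_and (env_definable_scalar 2 1 sa) (env_definable_zero 0 addL))
  (env_definable_add 1 3 0 addL))).
apply: env_definable_iff => e /=; rewrite mulNr.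
split=> [[u [v [[-> ->] /esym/eqP]]]|->]; first by rewrite addrC addr_eq0 => /eqP.
by exists (a * e 0%N), 0; rewrite subrr.
Qed.

Lemma env_definable_sumset A B :
  env_definable L (fun e => A (e 0%N)) -> env_definable L (fun e => B (e 0%N)) ->
  env_definable L (fun e => sumset A B (e 0%N)).
Proof.
move=> dA dB; have := env_definable_ex (env_definable_ex (env_definable_and
  (env_definable_and (env_definable_set 1 dA) (env_definable_set 0 dB))
  (env_definable_add 1 0 2 addL))).
apply: env_definable_iff => e /=.
split=> [[a [b [[Aa Bb] ->]]]|[a Aa [b Bb <-]]]; last by exists a, b.
by exists a => //; exists b.
Qed.

Lemma env_definable_dilate a A : scalar L a ->
  env_definable L (fun e => A (e 0%N)) ->
  env_definable L (fun e => dilate a A (e 0%N)).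
Proof.
move=> sa dA; have := env_definable_ex (env_definable_and
  (env_definable_set 0 dA) (env_definable_scalar 0 1 sa)).
apply: env_definable_iff => e /=.
by split=> [[x [Ax ->]]|[x Ax <-]]; exists x.
Qed.

Lemma env_definable_form K l : K `<=` scalar L -> linear_form K l ->
  env_definable L (fun e => e 0%N = l (fun j => e j.+1)).
Proof.
move=> KL; elim=> [i||l1 l2 _ h1 _ h2|c l1 Kc _ h1].
- have := env_definable_scalar i.+1 0 scalar1.
  by apply: env_definable_iff => e; rewrite mul1r.
- exact: env_definable_zero.
- pose r1 j := if j is j'.+1 then j'.+3 else 1%N.
  pose r2 j := if j is j'.+1 then j'.+3 else 0%N.
  have := env_definable_ex (env_definable_ex (env_definable_and
    (env_definable_and (env_definable_rename r1 h1) (env_definable_rename r2 h2))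
    (env_definable_add 1 0 2 addL))).
  apply: env_definable_iff => e /=.
  split=> [[u [v [[-> ->] ->]]]|->] //.
  by exists (l1 (fun j => e j.+1)), (l2 (fun j => e j.+1)).
- pose r1 j := if j is j'.+1 then j'.+2 else 0%N.
  have := env_definable_ex (env_definable_and
    (env_definable_rename r1 h1) (env_definable_scalar 0 1 (KL _ Kc))).
  apply: env_definable_iff => e /=.
  split=> [[u [-> ->]]|->] //.
  by exists (l1 (fun j => e j.+1)).
Qed.

Lemma env_definable_form_mem K l Z : K `<=` scalar L -> linear_form K l ->
  env_definable L (fun e => Z (e 0%N)) -> env_definable L (fun e => Z (l e)).
Proof.
move=> KL fl dZ.
have := env_definable_ex (env_definable_and (env_definable_form KL fl) dZ).
by apply: env_definable_iff => e; split=> [[a /= [-> //]]|Zl]; exists (l e).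
Qed.

End Scalars.
End LinearForms.

(** * Cells of affine arrangements *)

Section Arrangements.
Context {R : realType}.
Implicit Types (K : set R) (T : set (set R)).

(** Coefficients and cuts that are closed under elimination. Eliminating a variable [x]
    from the conditions [l + c * x = z] and [l' + c' * x = z'] yields the form
    [c' * l - c * l'] and the value [c' * z - c * z'], hence the need for sums and
    dilations. *)
Record cut_class K T : Prop := CutClass {
  coef0 : K 0;
  coef1 : K 1;
  coefD : forall a b, K a -> K b -> K (a + b);
  coefM : forall a b, K a -> K b -> K (a * b);
  coefN : forall a, K a -> K (- a);
  cut_closed : forall Z, T Z -> closed Z;
  cut_sumset : forall Z Z', T Z -> T Z' -> T (sumset Z Z');
  cut_dilate : forall a Z, K a -> T Z -> T (dilate a Z) }.

(** The hyperplanes [form j = z] with [z] in [cut j]; there are finitely many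
    directions, but as many parallel hyperplanes in each of them as [cut j] has
    elements. *)
Record arrangement K T := Arrangement {
  index : finType;
  form : index -> (nat -> R) -> R;
  cut : index -> set R;
  formP : forall j, linear_form K (form j);
  cutP : forall j, T (cut j) }.

Definition same_side (Z : set R) (a b : R) : Prop :=
  forall z, Z z -> (a < z) = (b < z) /\ (z < a) = (z < b).

Definition same_cell K T (H : arrangement K T) (e e' : nat -> R) : Prop :=
  forall j : index H, same_side (cut j) (form j e) (form j e').

Lemma same_side_sym Z a b : same_side Z a b -> same_side Z b a.
Proof. by move=> ab z /ab[-> ->]. Qed.

Lemma same_side_trans Z a b c : same_side Z a b -> same_side Z b c -> same_side Z a c.
Proof. by move=> ab bc z Zz; case: (ab z Zz) => -> ->; exact: bc. Qed.

Lemma same_side_mem Z a b : same_side Z a b -> Z a -> a = b.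
Proof.
by move=> ab /[dup]/ab; rewrite !ltxx; case: (ltgtP a b) => // _ [].
Qed.

Lemma conv_lt (a b z t : R) : 0 <= t <= 1 -> a < z -> b < z ->
  (1 - t) * a + t * b < z.
Proof.
move=> /andP[t0 t1] az bz; have [ab|/ltW ba] := leP a b.
  by apply: le_lt_trans bz; nra.
by apply: le_lt_trans az; nra.
Qed.

Lemma same_side_conv Z a b t : 0 <= t <= 1 -> same_side Z a b ->
  same_side Z a ((1 - t) * a + t * b).
Proof.
move=> t01 ab z Zz; case: (ltgtP a z) (ab z Zz) => az [/esym lt /esym gt].
- have cz := conv_lt t01 az lt.
  by rewrite cz ltNge (ltW cz).
- have := conv_lt (a := - a) (b := - b) (z := - z) t01.
  rewrite !ltrN2 => /(_ az gt) h.
  have zc : z < (1 - t) * a + t * b by rewrite -ltrN2; apply: le_lt_trans h; lra.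
  by rewrite zc ltNge (ltW zc).
- have -> : b = z by apply/eqP; rewrite eq_le !leNgt lt gt.
  by rewrite az -mulrDl subrK mul1r ltxx.
Qed.

Lemma same_cell_sym K T (H : arrangement K T) e e' :
  same_cell H e e' -> same_cell H e' e.
Proof. by move=> ee' j; exact: same_side_sym. Qed.

Lemma same_cell_trans K T (H : arrangement K T) e1 e2 e3 :
  same_cell H e1 e2 -> same_cell H e2 e3 -> same_cell H e1 e3.
Proof. by move=> e12 e23 j; exact: same_side_trans (e12 j) (e23 j). Qed.

Lemma same_cell_conv K T (H : arrangement K T) e e' t :
  0 <= t <= 1 -> same_cell H e e' ->
  same_cell H e (fun i => (1 - t) * e i + t * e' i).
Proof.
by move=> t01 ee' j; rewrite (form_comb _ _ _ _ (formP j)); exact: same_side_conv.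
Qed.

(** Closedness turns a bounded part of [W] into one with a greatest element. *)
Lemma closed_sup_lt (W : set R) (a : R) : closed W -> ~ W a ->
  (exists2 w, W w & w < a) ->
  exists w, [/\ W w, w < a & forall v, W v -> v < a -> v <= w].
Proof.
move=> clW nWa [w0 Ww0 w0a].
pose B := W `&` [set x | x <= a].
have B0 : B !=set0 by exists w0; split=> //; exact: ltW.
have ubB : has_ubound B by exists a => x [].
have clB : closed B by apply: closedI => //; exact: closed_le.
have [Ws sa] : B (sup B) by apply: clB; exact: closure_sup.
exists (sup B); split=> //.
  by rewrite lt_neqAle sa andbT; apply: contra_notN nWa => /eqP <-.
by move=> v Wv va; apply: ub_le_sup => //; split=> //; exact: ltW.
Qed.

Lemma closed_inf_gt (W : set R) (a : R) : closed W -> ~ W a ->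
  (exists2 w, W w & a < w) ->
  exists w, [/\ W w, a < w & forall v, W v -> a < v -> w <= v].
Proof.
move=> clW nWa [w0 Ww0 w0a].
have clN : closed [set x | W (- x)].
  by apply: closed_comp clW => x _; exact: opp_continuous.
have [||w [Ww wa wmax]] := closed_sup_lt (a := - a) clN.
- by rewrite /= opprK.
- by exists (- w0) => /=; rewrite ?opprK ?ltrN2.
exists (- w); split=> //; first by rewrite ltrNr.
by move=> v Wv av; rewrite lerNl; apply: wmax; rewrite /= ?opprK ?ltrN2.
Qed.

(** Two families of points in the same relative order cut the line in the same
    way. By closedness, if [a] is not in the first family then the points of the
    family on each side of [a], if any, include a nearest one; the new point is put
    between the corresponding points of the other family. *)
Lemma back_and_forth (I : Type) (q q' : I -> R) (a : R) :
  (forall s t, (q s < q t) = (q' s < q' t)) -> closed (range q) ->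
  exists a', forall t, (a < q t) = (a' < q' t) /\ (q t < a) = (q' t < a').
Proof.
move=> qq' clq.
have qqle s t : (q s <= q t) = (q' s <= q' t) by rewrite !leNgt qq'.
have [[s _ qs]|na] := pselect (range q a).
  by exists (q' s) => t; rewrite -qs !qq'.
have ne t : q t <> a by move=> qt; apply: na; exists t.
have lo : (exists2 s, q s < a & forall t, q t < a -> q t <= q s) \/
    forall t, a < q t.
  have [h|h] := pselect (exists2 w, range q w & w < a).
    have [w [[s _ <-] sa smax]] := closed_sup_lt clq na h.
    by left; exists s => // t ta; apply: smax => //; exists t.
  right=> t; rewrite ltNge le_eqVlt; apply/negP => /orP[/eqP/ne//|ta].
  by apply: h; exists (q t) => //; exists t.
have up : (exists2 s, a < q s & forall t, a < q t -> q s <= q t) \/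
    forall t, q t < a.
  have [h|h] := pselect (exists2 w, range q w & a < w).
    have [w [[s _ <-] sa smax]] := closed_inf_gt clq na h.
    by left; exists s => // t ta; apply: smax => //; exists t.
  right=> t; rewrite ltNge le_eqVlt; apply/negP => /orP[/eqP/esym/ne//|ta].
  by apply: h; exists (q t) => //; exists t.
suff [a' Ha'] : exists a', forall t, (a < q t -> a' < q' t) /\ (q t < a -> q' t < a').
  exists a' => t; have [gt_a lt_a] := Ha' t.
  case: (ltgtP a (q t)) => [/[dup]/gt_a h|/[dup]/lt_a h|/esym/ne//] _.
    by rewrite h ltNge (ltW h).
  by rewrite h ltNge (ltW h).
case: lo => [[s sa smax]|lo]; case: up => [[u ua umin]|up].
- have su : q' s < q' u by rewrite -qq'; exact: lt_trans ua.
  exists ((q' s + q' u) / 2) => t; split.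
    move=> /umin; rewrite qqle; apply: lt_le_trans; lra.
  move=> /smax; rewrite qqle => /le_lt_trans; apply; lra.
- exists (q' s + 1) => t; split; first by rewrite ltNge (ltW (up t)).
  move=> /smax; rewrite qqle => /le_lt_trans; apply; lra.
- exists (q' u - 1) => t; split; last by rewrite ltNge (ltW (lo t)).
  move=> /umin; rewrite qqle; apply: lt_le_trans; lra.
- by exists 0 => t; have := lt_trans (lo t) (up t); rewrite ltxx.
Qed.

(** Both sides compare two roots of affine equations; clearing the denominators
    leaves a linear form to be compared with an element of a cut. *)
Lemma lt_quotients (c c' m m' z z' : R) : c != 0 -> c' != 0 ->
  ((z - m) / c < (z' - m') / c') =
  if 0 < c * c' then c' * z + - c * z' < c' * m + - c * m'
  else c' * m + - c * m' < c' * z + - c * z'.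
Proof.
move=> c0 c'0; rewrite -subr_lt0.
have -> : (z - m) / c - (z' - m') / c' =
  ((c' * z + - c * z') - (c' * m + - c * m')) / (c * c') by field; rewrite c'0 c0.
case: (ltgtP 0 (c * c')) => [cc|cc|/esym/eqP]; last by rewrite (negPf (mulf_neq0 c0 c'0)).
  by rewrite pmulr_llt0 ?invr_gt0 // subr_lt0.
by rewrite nmulr_llt0 ?invr_lt0 // subr_gt0.
Qed.

Section Elimination.
Context (K : set R) (T : set (set R)) (KT : cut_class K T).
Context (i : nat) (H : arrangement K T).

Let rest (j : index H) (e : nat -> R) : R := form j (upd e i 0).
Let coef (j : index H) : R := form j (upd (fun=> 0) i 1).

Lemma form_coef l : linear_form K l -> K (l (upd (fun=> 0) i 1)).
Proof.
elim=> [k||l1 l2 _ K1 _ K2|c l1 Kc _ K1].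
- rewrite /upd; case: eqP => _; [exact: (coef1 KT)|exact: (coef0 KT)].
- exact: (coef0 KT).
- exact: (coefD KT).
- exact: (coefM KT).
Qed.

Definition elim_index : finType := (index H + index H * index H)%type.

Definition elim_form (s : elim_index) : (nat -> R) -> R :=
  match s with
  | inl j => rest j
  | inr (j, k) => fun e => coef k * rest j e + - coef j * rest k e
  end.

Definition elim_cut (s : elim_index) : set R :=
  match s with
  | inl j => cut j
  | inr (j, k) => sumset (dilate (coef k) (cut j)) (dilate (- coef j) (cut k))
  end.

Lemma elim_formP s : linear_form K (elim_form s).
Proof.
have fr j : linear_form K (rest j) by apply: form_upd0; exact: formP.
have fc j : K (coef j) by apply: form_coef; exact: formP.
case: s => [j|[j k]] /=; first exact: fr.
by apply: form_add; apply: form_scale => //; exact: (coefN KT).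
Qed.

Lemma elim_cutP s : T (elim_cut s).
Proof.
have fc j : K (coef j) by apply: form_coef; exact: formP.
case: s => [j|[j k]] /=; first exact: cutP.
by apply: (cut_sumset KT); apply: (cut_dilate KT); rewrite ?(coefN KT) //;
  [exact: cutP|exact: (coefN KT)|exact: cutP].
Qed.

Definition elim_var : arrangement K T := Arrangement elim_formP elim_cutP.

(** The range of [q] below consists of the points at which the hyperplanes meet the
    line along which the variable varies; the forms with zero coefficient are
    constant on that line. *)
Lemma elim_varP e e' : same_cell elim_var e e' ->
  forall a, exists a', same_cell H (upd e i a) (upd e' i a').
Proof.
move=> ee' a.
pose I := {t : index H * R | coef t.1 != 0 /\ cut t.1 t.2}.
pose q (e : nat -> R) (t : I) := ((sval t).2 - rest (sval t).1 e) / coef (sval t).1.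
have qq' s t : (q e s < q e t) = (q e' s < q e' t).
  case: s t => [[j z] [/= cj Zz]] [[k w] [/= ck Zw]]; rewrite /q /=.
  rewrite !lt_quotients //.
  have [|-> -> //] := ee' (inr (j, k)) (coef k * z + - coef j * w).
  by exists (coef k * z); [exists z|exists (- coef j * w); [exists w|]].
have clq : closed (range (q e)).
  rewrite (_ : range (q e) = \bigcup_(j in [set j | coef j != 0])
      ((fun x => coef j * x + rest j e) @^-1` cut j)).
    apply: closed_bigcup => [|j _]; first exact: finite_finset.
    apply: closed_comp (cut_closed KT (cutP j)) => x _.
    by apply: cvgD; [exact: mulrl_continuous|exact: cvg_cst].
  apply/seteqP; split=> x /=.
    move=> [[[j z] [/= cj Zz]] _ <-]; exists j => //=.
    by rewrite /q /= mulrC divfK // subrK.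
  move=> [j cj Zx]; exists (exist _ (j, _) (conj cj Zx)) => //.
  by rewrite /q /= addrK mulrC mulKf.
have [a' Ha'] := back_and_forth a qq' clq.
exists a' => j z Zz.
have updE f b : form j (upd f i b) = rest j f + coef j * b by exact: form_upd (formP j).
rewrite !updE.
have [cj|cj] := eqVneq (coef j) 0.
  by rewrite cj !mul0r !addr0; exact: (ee' (inl j)).
have := Ha' (exist _ (j, z) (conj cj Zz)); rewrite /q /=.
rewrite -!(ltrBrDl (coef j * _)) -!(ltrBlDl z) !(mulrC (coef j)).
case: (ltgtP (coef j) 0) cj => // cj _.
  by rewrite !ltr_ndivlMr // !ltr_ndivrMr // => -[-> ->].
by rewrite !ltr_pdivlMr // !ltr_pdivrMr // => -[-> ->].
Qed.

End Elimination.

Fixpoint elim_vars K T (KT : cut_class K T) (H : arrangement K T) (k m : nat) :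
    arrangement K T :=
  if m is m'.+1 then elim_var KT k (elim_vars KT H k.+1 m') else H.

Lemma elim_varsP K T (KT : cut_class K T) (H : arrangement K T) k m e e' :
  same_cell (elim_vars KT H k m) e e' ->
  forall g, exists g', same_cell H (splice k m g e) (splice k m g' e').
Proof.
elim: m k e e' => [|m IH] k e e' ee' g.
  by exists g; rewrite !splice0.
have [a' /IH/(_ g)[g' Hg]] := elim_varP ee' (g k).
exists (upd g' k a'); rewrite !spliceS (_ : upd g' k a' k = a'); last first.
  by rewrite /upd eqxx.
rewrite (splice_agree (g := upd _ _ _) (g' := g')) // => i /andP[ki _].
by rewrite /upd; case: eqP ki => // ->; rewrite ltnn.
Qed.

(** * Formulas do not separate the points of a cell *)

Definition decides K T (H : arrangement K T) (P : (nat -> R) -> Prop) : Prop :=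
  forall e e', same_cell H e e' -> P e <-> P e'.

Lemma decides_half K T (H : arrangement K T) (P : (nat -> R) -> Prop) :
  (forall e e', same_cell H e e' -> P e -> P e') -> decides H P.
Proof. by move=> h e e' ee'; split; apply: h => //; exact: same_cell_sym. Qed.

Definition cut_by K T (I : finType) (f : I -> (nat -> R) -> R) (Z : set R)
    (fP : forall j, linear_form K (f j)) (TZ : T Z) : arrangement K T :=
  Arrangement fP (fun=> TZ).

Definition join_arrangement K T (H H' : arrangement K T) : arrangement K T :=
  @Arrangement K T (index H + index H')%type
    (fun s => match s with inl j => form j | inr j => form j end)
    (fun s => match s with inl j => cut j | inr j => cut j end)
    (fun s => match s with inl j => formP j | inr j => formP j end)
    (fun s => match s with inl j => cutP j | inr j => cutP j end).

Lemma same_cell_join K T (H H' : arrangement K T) e e' :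
  same_cell (join_arrangement H H') e e' -> same_cell H e e' /\ same_cell H' e e'.
Proof. by move=> ee'; split=> j; [exact: (ee' (inl j))|exact: (ee' (inr j))]. Qed.

(** A point of the eliminated arrangement can follow any move of another point of
    its cell, so that a quantified formula does not separate them either. *)
Lemma formula_decided K T (KT : cut_class K T) (L : structure R) :
  (forall t u : term L,
     exists H : arrangement K T, decides H (fun e => holds e (Eq t u))) ->
  (forall s (a : 'I_(rar s) -> term L),
     exists H : arrangement K T, decides H (fun e => holds e (Rel a))) ->
  forall p : formula L, exists H : arrangement K T, decides H (fun e => holds e p).
Proof.
move=> hEq hRel; elim=> [t u|s a||p [Hp dp] q [Hq dq]|i p [H dH]].
- exact: hEq.
- exact: hRel.
- have [H _] := hEq (Var L 0) (Var L 0).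
  by exists H.
- exists (join_arrangement Hp Hq) => e e' /same_cell_join[/dp ep /dq eq] /=.
  tauto.
- exists (elim_var KT i H); apply: decides_half => e e' ee' /= h a'.
  have [a Ha] := elim_varP (same_cell_sym ee') a'.
  by apply/(dH _ _ Ha); exact: h.
Qed.

End Arrangements.

(** * Thin sets *)

Section ThinSets.
Context {R : realType}.
Implicit Types (L S : structure R) (A B D E F Z : set R).

(** Images of [F]-tuples under linear maps, with [F] the union of [D] and [E],
    are contained in sets of this shape. The two summands come from [D] and from
    [E] and are closed for different reasons: local o-minimality of [L1], and
    compactness. The whole set has to be definable only in the larger
    structure [L2]. *)
Definition thin L1 L2 Z : Prop :=
  env_definable L2 (fun e => Z (e 0%N)) /\
  exists A B, [/\ countable A, env_definable L1 (fun e => A (e 0%N)),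
                  compact B, countable B & Z = sumset A B].

Definition common_scalar L1 L2 : set R := [set a | scalar L1 a /\ scalar L2 a].

Lemma sumsetACA A B A' B' :
  sumset (sumset A B) (sumset A' B') = sumset (sumset A A') (sumset B B').
Proof.
apply/seteqP; split=> _ [_ [a Aa [b Bb <-]] [_ [a' Aa' [b' Bb' <-]] <-]];
  by rewrite addrACA; exists (a + a'); [exists a => //; exists a'|
    exists (b + b') => //; exists b => //; exists b'].
Qed.

Lemma dilate_sumset a A B : dilate a (sumset A B) = sumset (dilate a A) (dilate a B).
Proof.
apply/seteqP; split.
  move=> _ [_ [x Ax [y By <-]] <-]; rewrite mulrDr.
  by exists (a * x); [exists x|exists (a * y) => //; exists y].
move=> _ [_ [x Ax <-] [_ [y By <-] <-]]; rewrite -mulrDr.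
by exists (x + y) => //; exists x => //; exists y.
Qed.

Lemma sumset00 : sumset [set 0] [set 0] = [set 0 : R].
Proof.
apply/seteqP; split; first by move=> _ [_ -> [_ -> <-]]; rewrite /= addr0.
by move=> _ ->; exists 0 => //; exists 0 => //; rewrite addr0.
Qed.

Lemma definable1_env L A : env_definable L (fun e => A (e 0%N)) -> definable1 L A.
Proof.
move=> /(definable_env 1 (fun=> 0)); congr definable.
by apply/seteqP; split=> x /=; rewrite -(env_lt x (fun=> 0) ord0).
Qed.

Lemma thin_countable L1 L2 Z : thin L1 L2 Z -> countable Z.
Proof. by move=> [_ [A [B [cA _ _ cB ->]]]]; exact: countable_sumset. Qed.

Lemma thin_cut_class L1 L2 :
  addition_definable L1 -> addition_definable L2 -> locally_ominimal L1 ->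
  cut_class (common_scalar L1 L2) (thin L1 L2).
Proof.
move=> add1 add2 lo; split.
- by split; exact: scalar0.
- by split; exact: scalar1.
- by move=> a b [a1 a2] [b1 b2]; split; exact: scalarD.
- by move=> a b [a1 a2] [b1 b2]; split; exact: scalarM.
- by move=> a [a1 a2]; split; exact: scalarN.
- move=> Z [_ [A [B [cA dA kB _ ->]]]]; apply: closed_sumset => //.
  exact: locally_ominimal_closed lo cA (definable1_env dA).
- move=> Z Z' [dZ [A [B [cA dA kB cB ZE]]]] [dZ' [A' [B' [cA' dA' kB' cB' ZE']]]].
  split; first exact: env_definable_sumset.
  exists (sumset A A'), (sumset B B'); split.
  + exact: countable_sumset.
  + exact: env_definable_sumset.
  + exact: compact_sumset.
  + exact: countable_sumset.
  + by rewrite ZE ZE' sumsetACA.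
- move=> a Z [a1 a2] [dZ [A [B [cA dA kB cB ZE]]]].
  split; first exact: env_definable_dilate.
  exists (dilate a A), (dilate a B); split.
  + exact: countable_dilate.
  + exact: env_definable_dilate.
  + exact: compact_dilate.
  + exact: countable_dilate.
  + by rewrite ZE dilate_sumset.
Qed.

Lemma env_definable_set1_0 L : addition_definable L ->
  env_definable L (fun e => [set 0 : R] (e 0%N)).
Proof. exact: env_definable_zero. Qed.

Lemma thin0 L1 L2 : addition_definable L1 -> addition_definable L2 ->
  thin L1 L2 [set 0].
Proof.
move=> add1 add2; split; first exact: env_definable_set1_0.
exists [set 0], [set 0]; split; rewrite ?sumset00 //;
  [exact: env_definable_set1_0|exact: compact_set1].
Qed.

(** * The two base structures *)

Definition base_structure S := S = ordered_group R \/ S = ordered_vector_space R.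

Lemma base_addition S (hS : base_structure S) (I : Type) (ar : I -> nat)
    (P : forall i, set 'rV[R]_(ar i)) : addition_definable (expansion S P).
Proof.
case: hS => ->.
- exists (Eq (Var (expansion (ordered_group R) P) 2)
   (@App _ (expansion (ordered_group R) P) GAdd (fun i => Var _ i))) => e /=.
  by rewrite !mxE.
- exists (Eq (Var (expansion (ordered_vector_space R) P) 2)
   (@App _ (expansion (ordered_vector_space R) P) (inl GAdd) (fun i => Var _ i))) => e /=.
  by rewrite !mxE.
Qed.

Lemma vector_space_scalar (I : Type) (ar : I -> nat)
    (P : forall i, set 'rV[R]_(ar i)) (a : R) :
  scalar (expansion (ordered_vector_space R) P) a.
Proof.
exists (Eq (Var (expansion (ordered_vector_space R) P) 1)
  (@App _ (expansion (ordered_vector_space R) P) (inr a) (fun i => Var _ i))) => e /=.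
by rewrite !mxE.
Qed.

Lemma term_linear_form S (hS : base_structure S) (I : Type) (ar : I -> nat)
    (P : forall i, set 'rV[R]_(ar i)) (K : set R)
    (SK : S = ordered_vector_space R -> forall a, K a) (t : term (expansion S P)) :
  linear_form K (fun e => Defs.eval e t).
Proof.
have formE (l l' : (nat -> R) -> R) : (forall e, l e = l' e) ->
    linear_form K l -> linear_form K l'.
  by move=> ll'; rewrite (funext ll').
case: hS SK t => -> SK; elim=> [i|s a IH]; do ?exact: form_var.
- case: s a IH => /= a IH; last exact: form_zero.
  by apply: formE (form_add (IH ord0) (IH ord_max)) => e; rewrite !mxE.
- case: s a IH => [[]|c] /= a IH; last 1 first.
  + apply: formE (form_scale (SK erefl c) (IH ord0)) => e; rewrite !mxE.
    by [].
  + by apply: formE (form_add (IH ord0) (IH ord_max)) => e; rewrite !mxE.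
  + exact: form_zero.
Qed.

Lemma sharp_subset S F A : A `<=` F ->
  env_definable (sharp S F) (fun e => A (e 0%N)).
Proof.
move=> AF; have [[a0 Aa0]|A0] := pselect (A !=set0); last first.
  apply: env_definable_iff (env_definable_cst _ False) => e.
  by split=> // Ae; apply: A0; exists (e 0%N).
pose X := [set x : 'rV[R]_1 | A (x ord0 ord0)].
have X0 : X !=set0 by exists (\row__ a0); rewrite /X /= mxE.
have XF x : X x -> forall i, F (x ord0 i) by move=> Xx i; rewrite (ord1 i); exact: AF.
exists (@Rel _ (sharp S F) (inr (PowerSubset (isT : (0 < 1)%N) X0 XF))
  (fun=> Var _ 0)) => e.
by rewrite /= /X /= mxE.
Qed.

Lemma expansion1_set S D : env_definable (expansion1 S D) (fun e => D (e 0%N)).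
Proof.
exists (@Rel _ (expansion1 S D) (inr tt) (fun=> Var _ 0)) => e.
by rewrite /= mxE.
Qed.

(** The point [0] is added to [D] and [E] in order that the sum contain their
    union. *)
Lemma thin_sum S (hS : base_structure S) D E : countable D -> compact E -> countable E ->
  thin (expansion1 S D) (sharp S (D `|` E)) (sumset (D `|` [set 0]) (E `|` [set 0])).
Proof.
move=> cD kE cE; have addL := base_addition hS.
have cU A : countable A -> countable (A `|` [set 0 : R]).
  by move=> cA; rewrite -bigcup2E; apply: bigcup_countable => // -[|[|i]] _ //=.
have dU L A : addition_definable L -> env_definable L (fun e => A (e 0%N)) ->
    env_definable L (fun e => (A `|` [set 0 : R]) (e 0%N)).
  by move=> aL dA; apply: env_definable_or dA (env_definable_zero 0 aL).
split.
  apply: env_definable_sumset; first exact: addL.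
    by apply: dU; [exact: addL|apply: sharp_subset => x; left].
  by apply: dU; [exact: addL|apply: sharp_subset => x; right].
exists (D `|` [set 0]), (E `|` [set 0]); split => //; do ?exact: cU.
- by apply: dU; [exact: addL|exact: expansion1_set].
- by apply: compactU => //; exact: compact_set1.
Qed.

Lemma sub_sumset0 D E : D `|` E `<=` sumset (D `|` [set 0]) (E `|` [set 0]).
Proof.
move=> x [Dx|Ex].
- by exists x; [left|exists 0; [right|rewrite addr0]].
- by exists 0; [right|exists x; [left|rewrite add0r]].
Qed.

(** A relation on [F] can hold only if its terms take values in the cut [F0], and a
    cell determines the values of its forms that belong to a cut. *)
Lemma sharp_formula_decided S (hS : base_structure S) F K T (KT : cut_class K T)
    (SK : S = ordered_vector_space R -> forall a, K a) (T0 : T [set 0])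
    F0 (TF0 : T F0) (FF0 : F `<=` F0) (p : formula (sharp S F)) :
  exists H : arrangement K T, decides H (fun e => holds e p).
Proof.
have tform := term_linear_form hS (P := @ps_set R F) SK.
have bform (t u : term (sharp S F)) (_ : unit) :
    linear_form K (fun e => Defs.eval e t + -1 * Defs.eval e u).
  apply: form_add (tform t) (form_scale _ (tform u)).
  exact: (coefN KT (coef1 KT)).
have deq (t u : term (sharp S F)) : exists H : arrangement K T, forall e e',
    same_cell H e e' ->
    ((Defs.eval e t < Defs.eval e u) = (Defs.eval e' t < Defs.eval e' u) /\
     (Defs.eval e t = Defs.eval e u <-> Defs.eval e' t = Defs.eval e' u)).
  exists (cut_by (bform t u) T0) => e e' /(_ tt 0 erefl) /=.
  rewrite !mulN1r !subr_lt0 !subr_gt0 => -[lt gt]; split=> //.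
  have eqE (x y : R) : x = y <-> (x < y) = false /\ (y < x) = false.
    split=> [->|[xy yx]]; first by rewrite ltxx.
    by apply/eqP; rewrite eq_le !leNgt xy yx.
  by rewrite !eqE lt gt.
apply: formula_decided => // [t u|s a].
  by have [H dH] := deq t u; exists H => e e' /dH[].
have dps (ps : power_subset F) (b : 'I_(ps_dim ps) -> term (sharp S F)) :
  exists H : arrangement K T,
    decides H (fun e => ps_set (\row_i Defs.eval e (b i))).
  exists (cut_by (fun i => tform (b i)) TF0); apply: decides_half => e e' ee' bS.
  rewrite (_ : \row_i _ = \row_i Defs.eval e (b i)) //.
  apply/rowP => i; rewrite !mxE; apply/esym/(same_side_mem (ee' i)) => /=.
  by apply: FF0; have := ps_sub bS i; rewrite mxE.
case: hS s a deq dps {tform bform SK} => -> [[]|ps] a deq dps; do ?exact: dps.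
- have [H dH] := deq (a ord0) (a ord_max).
  by exists H => e e' /dH[lt _]; rewrite /= /lt_rint /= !mxE lt.
- have [H dH] := deq (a ord0) (a ord_max).
  by exists H => e e' /dH[lt _]; rewrite /= /lt_rint /= !mxE lt.
Qed.

End ThinSets.

(** * Functions that preserve convex combinations *)

Section LocalAffinity.
Context {R : realType} {n m : nat}.
Context (f : 'rV[R]_n -> 'rV[R]_m) (x0 : 'rV[R]_n) (r : R) (r_gt0 : 0 < r).
Context (f_conv : forall (x y : 'rV[R]_n) (t : R),
  `|x - x0| < r -> `|y - x0| < r -> 0 <= t <= 1 ->
  f ((1 - t) *: x + t *: y) = (1 - t) *: f x + t *: f y).
Implicit Types (h k : 'rV[R]_n) (s t c : R).

Let g (h : 'rV[R]_n) : 'rV[R]_m := f (h + x0) - f x0.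

Let g_conv h k t : `|h| < r -> `|k| < r -> 0 <= t <= 1 ->
  g ((1 - t) *: h + t *: k) = (1 - t) *: g h + t *: g k.
Proof.
move=> hr kr t01; rewrite /g.
have -> : (1 - t) *: h + t *: k + x0 = (1 - t) *: (h + x0) + t *: (k + x0).
  by apply/rowP => i; rewrite !mxE; ring.
by rewrite f_conv ?addrK //; apply/rowP => i; rewrite !mxE; ring.
Qed.

Let g0 : g 0 = 0. Proof. by rewrite /g add0r subrr. Qed.

Let g_scale h t : `|h| < r -> 0 <= t <= 1 -> g (t *: h) = t *: g h.
Proof.
move=> hr t01; have := g_conv (h := 0) (k := h) (t := t).
by rewrite g0 !scaler0 !add0r normr0; apply.
Qed.

(** The difference quotients of [g] at [0] in direction [h] are constant; [G] is
    their common value, hence defined on all vectors. *)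
Let G (h : 'rV[R]_n) : 'rV[R]_m :=
  let s := r / (1 + `|h|) in s^-1 *: g (s *: h).

Let scale_small s h : 0 < s -> s * `|h| < r -> `|s *: h| < r.
Proof. by move=> s0; rewrite normrZ gtr0_norm. Qed.

Let quotient_le h s s' : 0 < s -> s <= s' -> s' * `|h| < r ->
  s^-1 *: g (s *: h) = s'^-1 *: g (s' *: h).
Proof.
move=> s0 ss' hr; have s'0 := lt_le_trans s0 ss'.
have -> : s *: h = (s / s') *: (s' *: h) by rewrite scalerA divfK ?gt_eqF.
rewrite g_scale ?scale_small //; last first.
  by rewrite (divr_ge0 (ltW s0) (ltW s'0)) ler_pdivrMr ?mul1r.
by rewrite scalerA mulrA mulVf ?mul1r ?gt_eqF.
Qed.

Let GE h s : 0 < s -> s * `|h| < r -> G h = s^-1 *: g (s *: h).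
Proof.
move=> s0 sr; rewrite /G; set s' := r / _.
have h1 : 0 < 1 + `|h| by rewrite ltr_pwDl.
have s'0 : 0 < s' by rewrite divr_gt0.
have s'r : s' * `|h| < r.
  by rewrite /s' mulrAC ltr_pdivrMr // ltr_pM2l // ltrDr.
by have [ss'|/ltW ss'] := leP s s'; 
  [rewrite (quotient_le s0 ss')|rewrite (quotient_le s'0 ss')].
Qed.

Let small h : exists2 s, 0 < s & s * `|h| < r.
Proof.
have h1 : 0 < 1 + `|h| by rewrite ltr_pwDl.
exists (r / (1 + `|h|)); first by rewrite divr_gt0.
by rewrite mulrAC ltr_pdivrMr // ltr_pM2l // ltrDr.
Qed.

Let G0 : G 0 = 0. Proof. by rewrite /G scaler0 g0 scaler0. Qed.

Let GD h k : G (h + k) = G h + G k.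
Proof.
have [s1 s1_gt0 hs1] := small h; have [s2 s2_gt0 ks2] := small k.
pose s := Num.min s1 s2.
have s0 : 0 < s by rewrite lt_min s1_gt0.
have hs : s * `|h| < r.
  by apply: le_lt_trans hs1; rewrite ler_wpM2r // ge_min lexx.
have ks : s * `|k| < r.
  by apply: le_lt_trans ks2; rewrite ler_wpM2r // ge_min lexx orbT.
have hks : s / 2 * `|h + k| < r.
  have := ler_wpM2l (ltW s0) (ler_normD h k); rewrite mulrDr; lra.
rewrite (GE _ hks) ?divr_gt0 // (GE s0 hs) (GE s0 ks).
have -> : (s / 2) *: (h + k) = (1 - 2^-1) *: (s *: h) + 2^-1 *: (s *: k).
  by apply/rowP => i; rewrite !mxE; field.
rewrite g_conv ?scale_small //; last by lra.
by apply/rowP => i; rewrite !mxE; field; rewrite gt_eqF.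
Qed.

Let GZ_gt0 c h : 0 < c -> G (c *: h) = c *: G h.
Proof.
move=> c0; have [s s0 hs] := small (c *: h).
have hs' : s * c * `|h| < r by move: hs; rewrite normrZ (gtr0_norm c0) mulrA.
rewrite (GE s0 hs) (GE _ hs') ?mulr_gt0 // scalerA scalerA.
by rewrite invfM mulrCA divff ?gt_eqF // mulr1.
Qed.

Let GN h : G (- h) = - G h.
Proof. by apply/eqP; rewrite -addr_eq0 -GD addNr G0. Qed.

Let GZ c h : G (c *: h) = c *: G h.
Proof.
case: (ltgtP c 0) => [c0|c0|->]; last by rewrite !scale0r G0.
  have := @GZ_gt0 (- c) h; rewrite oppr_gt0 !scaleNr GN => /(_ c0).
  exact: oppr_inj.
exact: GZ_gt0.
Qed.

(** The function [F] extends [f] by homogeneity with respect to the centre [x0];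
    the extension is additive because midpoints are convex combinations. *)
Lemma conv_affine : exists2 F, affine_map F &
  forall x, `|x - x0| < r -> f x = F x.
Proof.
have Glin : linear G by move=> c h k; rewrite GD GZ.
pose GL : {linear 'rV[R]_n -> 'rV[R]_m} :=
  HB.pack_for {linear 'rV[R]_n -> 'rV[R]_m} G (GRing.isLinear.Build _ _ _ _ G Glin).
pose A := lin1_mx GL.
exists (fun x => x *m A + (f x0 - x0 *m A)); first by exists A, (f x0 - x0 *m A).
move=> x xr; rewrite addrCA -mulmxBl mul_rV_lin1 /= (GE (s := 1)) ?mul1r //.
by rewrite invr1 !scale1r /g subrK addrC subrK.
Qed.

End LocalAffinity.

(** * Generic points and graphs *)

Section Generic.
Context {R : realType}.
Implicit Types (K : set R) (T : set (set R)) (Z : set R).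

Lemma env_comb n (x x' : 'rV[R]_n) e t :
  env ((1 - t) *: x + t *: x') e = fun i => (1 - t) * env x e i + t * env x' e i.
Proof.
apply/funext => i; have [lt_in|ni] := ltnP i n.
  by rewrite !(env_lt _ e (Ordinal lt_in)) !mxE.
by rewrite !env_ge // -mulrDl subrK mul1r.
Qed.

Lemma env_row_mx_l n m (x : 'rV[R]_n) (y : 'rV[R]_m) e i : (i < n)%N ->
  env (row_mx x y) e i = env x e i.
Proof.
move=> lt_in; rewrite (env_lt (row_mx x y) e (lshift m (Ordinal lt_in))).
by rewrite row_mxEl (env_lt x e (Ordinal lt_in)).
Qed.

Lemma splice_env n m (x : 'rV[R]_n) (y : 'rV[R]_m) g e :
  (forall j : 'I_m, g (n + j)%N = y ord0 j) ->
  splice n m g (env x e) = env (row_mx x y) e.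
Proof.
move=> gy; apply/funext => i; rewrite /splice.
have [ni|lt_in] /= := leqP n i; last by rewrite env_row_mx_l.
have [lt_im|mi] := ltnP i (n + m); last by rewrite !env_ge.
have lt_im' : (i - n < m)%N by rewrite ltn_subLR.
have [j ->] : exists j : 'I_m, i = (n + j)%N.
  by exists (Ordinal lt_im'); rewrite /= subnKC.
by rewrite gy -(row_mxEr x y ord0 j) -(env_lt _ e).
Qed.

Lemma form_env_line K l n (x u v : 'rV[R]_n) e t : linear_form K l ->
  l (env (x + t *: (v - u)) e) = l (env x e) + t * (l (env v e) - l (env u e)).
Proof.
move=> fl; have -> : env (x + t *: (v - u)) e =
   fun i => 1 * env x e i + t * (1 * env v e i + -1 * env u e i).
  apply/funext => i; have [lt_in|ni] := ltnP i n.
    by rewrite !(env_lt _ e (Ordinal lt_in)) !mxE; ring.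
  by rewrite !env_ge //; ring.
by rewrite (form_comb _ _ _ _ fl) (form_comb _ _ _ _ fl); ring.
Qed.

(** Along a line on which the form is not constant, the values that belong to [Z]
    are taken at countably many points. *)
Lemma dense_form_avoid K l n (e : nat -> R) Z :
  linear_form K l -> countable Z ->
  ~ (forall x x' : 'rV[R]_n, l (env x e) = l (env x' e)) ->
  dense [set x : 'rV[R]_n | ~ Z (l (env x e))].
Proof.
move=> fl cZ nconst O [x Ox] oO.
have [u [v luv]] : exists u v : 'rV[R]_n, l (env u e) != l (env v e).
  apply: contrapT => h; apply: nconst => u v; apply: contrapT => luv.
  by apply: h; exists u, v; apply/eqP.
pose c := l (env v e) - l (env u e).
have c0 : c != 0 by rewrite subr_eq0 eq_sym.
have line : (fun t : R => x + t *: (v - u)) @ (0 : R) --> x + (0 : R) *: (v - u).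
  by apply: cvgD; [exact: cvg_cst|exact: scalel_continuous].
rewrite scale0r addr0 in line.
have /nbhs_ballP[d /= d0 dO] := line _ (open_nbhs_nbhs (conj oO Ox)).
have cZ' : countable ((fun z => (z - l (env x e)) / c) @` Z).
  by apply: sub_countable (card_image_le _ _) cZ.
have [t /andP[t0 td] nZt] := countable_avoid cZ' d0.
exists (x + t *: (v - u)); split.
  by apply: dO; rewrite /ball /= sub0r normrN gtr0_norm.
move=> /=; rewrite (form_env_line _ _ _ _ _ fl) -/c => Zt; apply: nZt.
by exists (l (env x e) + t * c) => //; rewrite addrC addKr mulfK.
Qed.

Lemma near_same_side Z (a : R) : closed Z -> ~ Z a ->
  \forall b \near a, same_side Z a b.
Proof.
move=> clZ nZa.
have /nbhs_ballP[d /= d0 dZ] : nbhs a (~` Z).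
  by apply: open_nbhs_nbhs; split; first exact: closed_openC.
apply/nbhs_ballP; exists d => //= b; rewrite /ball /= ltr_distl => /andP[ab ba] z Zz.
have {dZ} : ~ (a - d < z < a + d).
  by move=> h; apply: (dZ z) => //; rewrite /ball /= distrC ltr_distl.
case: (ltgtP a z) => [az|za|az].
- move=> h; have {h}dz : a + d <= z.
    by rewrite leNgt; apply/negP => zd; apply: h; rewrite zd andbT; lra.
  have bz : b < z by lra.
  by rewrite bz ltNge (ltW bz).
- move=> h; have {h}dz : z <= a - d.
    by rewrite leNgt; apply/negP => zd; apply: h; rewrite zd /=; lra.
  have bz : z < b by lra.
  by rewrite bz ltNge (ltW bz).
- by rewrite az in nZa.
Qed.

Lemma dense_setT (X : topologicalType) : dense [set: X].
Proof. by move=> O [x Ox] _; exists x. Qed.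

Lemma open_dense_all (X : topologicalType) (I : finType) (G : I -> set X) :
  (forall i, open (G i)) -> (forall i, dense (G i)) ->
  dense [set x | forall i, G i x].
Proof.
move=> oG dG.
suff H (s : seq I) : open [set x | forall i, i \in s -> G i x] /\
    dense [set x | forall i, i \in s -> G i x].
  have := (H (enum I)).2; congr dense; apply/seteqP; split=> x Gx i.
    by apply: Gx; rewrite mem_enum.
  by move=> _; exact: Gx.
elim: s => [|i s [oIH dIH]].
  rewrite (_ : [set x | _] = setT); first by split; [exact: openT|exact: dense_setT].
  by apply/seteqP; split.
rewrite (_ : [set x | _] = G i `&` [set x | forall j, j \in s -> G j x]).
  by split; [exact: openI|exact: denseI].
apply/seteqP; split=> x /=.
  by move=> Gx; split=> [|j js]; apply: Gx; rewrite in_cons ?eqxx ?js ?orbT.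
by move=> [Gi Gs] j; rewrite in_cons => /orP[/eqP->|/Gs].
Qed.

(** The forms that do not depend on the first [n] coordinates are exempted: their
    value may belong to the cut at every point, but they separate no two points. *)
Definition generic K T (H : arrangement K T) n (e : nat -> R) : set 'rV[R]_n :=
  [set x | forall j : index H,
    ~ (forall y y' : 'rV[R]_n, form j (env y e) = form j (env y' e)) ->
    ~ cut j (form j (env x e))].

Section GenericPoints.
Context (K : set R) (T : set (set R)) (KT : cut_class K T) (H : arrangement K T).
Context (n : nat) (e : nat -> R).

Let bad (j : index H) : Prop :=
  ~ (forall y y' : 'rV[R]_n, form j (env y e) = form j (env y' e)).

Let open_good j : open [set x : 'rV[R]_n | bad j -> ~ cut j (form j (env x e))].
Proof.
have [bj|nbj] := pselect (bad j); last first.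
  rewrite (_ : [set x | _] = setT); first exact: openT.
  by apply/seteqP; split=> x //= _ bj; case: (nbj bj).
rewrite (_ : [set x | _] = (fun x => form j (env x e)) @^-1` ~` cut j).
  apply: open_comp (closed_openC (cut_closed KT (cutP j))) => x _.
  exact: form_continuous (formP j) x.
by apply/seteqP; split=> x /=; [apply|].
Qed.

Lemma generic_open : open (generic H (n := n) e).
Proof.
rewrite openE => x Gx; apply: (@filter_forall _ _ (fun (j : index H) y =>
  bad j -> ~ cut j (form j (env y e))) (nbhs x)) => j.
by apply: open_nbhs_nbhs; split; [exact: open_good|exact: Gx].
Qed.

Lemma generic_dense : (forall Z, T Z -> countable Z) -> dense (generic H (n := n) e).
Proof.
move=> cT; apply: open_dense_all open_good _ => j.
have [bj|nbj] := pselect (bad j); last first.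
  rewrite (_ : [set x | _] = setT); first exact: dense_setT.
  by apply/seteqP; split=> x //= _ bj; case: (nbj bj).
rewrite (_ : [set x | _] = [set x : 'rV[R]_n | ~ cut j (form j (env x e))]).
  exact: dense_form_avoid (formP j) (cT _ (cutP j)) bj.
by apply/seteqP; split=> x /=; [apply|].
Qed.

Lemma generic_cell (x : 'rV[R]_n) : generic H e x ->
  \forall x' \near x, same_cell H (env x e) (env x' e).
Proof.
move=> Gx; apply: (@filter_forall _ _ (fun (j : index H) y =>
  same_side (cut j) (form j (env x e)) (form j (env y e))) (nbhs x)) => j.
have [bj|nbj] := pselect (bad j); last first.
  by apply: nearW => x' z _; rewrite (contrapT nbj x x').
have near_a := near_same_side (cut_closed KT (cutP j)) (Gx j bj).
have cont_j := @form_continuous R K _ n e (formP j) x.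
exact: cont_j near_a.
Qed.

End GenericPoints.

(** Above the cell of [x] in the eliminated arrangement, the graph of [f] lies in
    the cell of [H] through [(x, f x)], which is convex and contained in the graph.
    Thus [f] preserves convex combinations near [x]. *)
Lemma graph_decided_affine K T (KT : cut_class K T) (H : arrangement K T) n m
    (U : set 'rV[R]_n) (f : 'rV[R]_n -> 'rV[R]_m) (e : nat -> R)
    (P : (nat -> R) -> Prop) (x : 'rV[R]_n) :
  decides H P ->
  (forall x y, P (env (row_mx x y) e) <-> U x /\ y = f x) ->
  U x -> generic (elim_vars KT H n m) e x ->
  exists2 r, 0 < r & exists2 F, affine_map F & forall x', ball x r x' -> f x' = F x'.
Proof.
move=> dP graphP Ux /(generic_cell KT)/nbhs_ballP[r /= r0 near_x].
have cell x' : ball x r x' ->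
    U x' /\ same_cell H (env (row_mx x (f x)) e) (env (row_mx x' (f x')) e).
  move=> /near_x/elim_varsP/(_ (fun i => env (f x) e (i - n)))[g' Hg].
  move: Hg; rewrite (@splice_env n m _ (f x)) => [|j]; last first.
    by rewrite addKn (env_lt _ e j).
  rewrite (@splice_env n m _ (\row_(j < m) g' (n + j)%N)) => [Hg|j]; last by rewrite mxE.
  have /graphP[Ux' <-] := (dP _ _ Hg).1 ((graphP _ _).2 (conj Ux erefl)).
  by split.
exists r => //; have [||F aF FE] := @conv_affine R n m f x r.
- exact: r0.
- move=> y z t yr zr t01.
  have inball u : `|u - x| < r -> ball x r u by rewrite -ball_normE /= distrC.
  have [Uy cy] := cell y (inball y yr); have [Uz cz] := cell z (inball z zr).
  have := same_cell_conv t01 (same_cell_trans (same_cell_sym cy) cz).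
  rewrite -env_comb !scale_row_mx add_row_mx => /dP[h _].
  by have /graphP[_ <-] := h ((graphP _ _).2 (conj Uy erefl)).
exists F => // x'; rewrite -ball_normE /= distrC; exact: FE.
Qed.

End Generic.

Unset Implicit Arguments.
Set Strict Implicit.
Set Printing Implicit Defensive.

Theorem theorem1p6 (R : realType) (S : structure R)
    (hS : S = ordered_group R \/ S = ordered_vector_space R)
    (D : set R) (hD : countable D)
    (hSD : locally_ominimal (expansion1 S D))
    (E : set R) (hEcompact : compact E) (hEdiscrete : finite_union_discrete E)
    (n m : nat) (U : set 'rV[R]_n) (hU : open U)
    (f : 'rV[R]_n -> 'rV[R]_m) (hfcont : {within U, continuous f})
    (hfdef : definable_fun (sharp S (D `|` E)) U f) :
  exists V : set 'rV[R]_n,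
    [/\ V `<=` U, U `<=` closure V, open V,
        definable (sharp S (D `|` E)) V
      & locally_affine V f].
Proof.
have cE := finite_union_discrete_countable hEdiscrete.
pose L1 := expansion1 S D; pose L2 := sharp S (D `|` E).
have add1 : addition_definable L1 by exact: base_addition.
have add2 : addition_definable L2 by exact: base_addition.
pose K := common_scalar L1 L2; pose T := thin L1 L2.
have KT : cut_class K T by exact: thin_cut_class.
have SK : S = ordered_vector_space R -> forall a, K a.
  by rewrite /K /L1 /L2 => -> a; split; exact: vector_space_scalar.
have [p [e pE]] := hfdef.
have graphP (x : 'rV[R]_n) (y : 'rV[R]_m) :
    holds (env (row_mx x y) e) p <-> U x /\ y = f x.
  rewrite -[holds _ _]/([set w : 'rV[R]_(n + m) | holds (env w e) p] (row_mx x y)) -pE /=.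
  split=> [[x' Ux' /eq_row_mx[<- <-]] //|[Ux ->]].
  by exists x.
have [H dH] := sharp_formula_decided hS KT SK (thin0 add1 add2)
  (thin_sum hS hD hEcompact cE) (@sub_sumset0 R D E) p.
pose H' := elim_vars KT H n m.
exists (U `&` generic H' e).
have oV : open (U `&` generic H' e) by apply: openI => //; exact: generic_open.
split=> //.
- move=> x Ux B; rewrite nbhsE => -[W [oW Wx] WB].
  have WU0 : W `&` U !=set0 by exists x.
  have [x' [[Wx' Ux'] Gx']] := generic_dense KT H' (n := n) e
    (@thin_countable R L1 L2) WU0 (openI oW hU).
  by exists x'; split=> //; exact: WB.
- have dp : env_definable L2 (fun e' => exists g, holds (splice n m g e') p).
    by apply: (@env_definable_ex_splice _ L2 (fun e' => holds e' p)); exists p.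
  have dG : env_definable L2 (fun e' => forall j : index H',
     ~ (forall y y' : 'rV[R]_n, form j (env y e) = form j (env y' e)) ->
     ~ cut j (form j e')).
    apply: env_definable_all_fin => j.
    apply: env_definable_imp (env_definable_cst _ _) _.
    apply: env_definable_not; apply: env_definable_form_mem (formP j) (cutP j).1 => //.
    by move=> a [].
  have := definable_env n e (env_definable_and dp dG); congr definable.
  apply/seteqP; split=> x /= [h Gx]; split=> //.
    have [g] := h; rewrite (@splice_env R n m _ (\row_(j < m) g (n + j)%N)) => [|j].
      by move=> /graphP[].
    by rewrite mxE.
  exists (fun i => env (f x) e (i - n)); rewrite (@splice_env R n m _ (f x)) => [|j].
    exact/graphP.
  by rewrite addKn (env_lt _ e j).
- move=> x [Ux Gx].
  have [r r0 [F aF FE]] := graph_decided_affine dH graphP Ux Gx.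
  exists (ball x r `&` (U `&` generic H' e)); split.
  + by apply: openI => //; exact: ball_open.
  + by split=> //; exact: ballxx.
  + by move=> y [].
  + by exists F => // y [/FE].
Qed.
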